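(* Let $q\in L_2(0,\pi)$ be real-valued, let $h,\widetilde h,H,H_1,H_2\in\mathbb{R}$ with $h<\widetilde h$ and $\rho:=HH_1-H_2>0$. Let $\lambda_0<\lambda_1<\lambda_2<\dots$ and $\mu_0<\mu_1<\mu_2<\dots$ be the eigenvalues of the problems $\mathcal{P}(q,h,H,H_1,H_2)$ and $\mathcal{P}(q,\widetilde h,H,H_1,H_2)$, respectively, and let $\{\gamma_n\}_{n\ge0}$ be the norming constants of $\mathcal{P}(q,h,H,H_1,H_2)$. Then $$\lambda_0<\mu_0<\lambda_1<\mu_1<\lambda_2<\mu_2<\dots$$ and $$\gamma_n=(h-\widetilde h)\,\frac{\dot\Phi(\lambda_n)}{\Psi(\lambda_n)},\qquad n\ge0,$$ where $\Phi$ and $\Psi$ are the characteristic functions defined in the context and $\dot\Phi=\frac{d\Phi}{d\lambda}$.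
   Context: $\mathcal{P}(q,h,H,H_1,H_2)$ denotes the eigenvalue problem $$-y''(x)+q(x)y(x)=\lambda y(x),\quad x\in[0,\pi],$$ $$y'(0)-hy(0)=0,\qquad \lambda\,(y'(\pi)+Hy(\pi))=H_1y'(\pi)+H_2y(\pi).$$ Its eigenvalues form a countably infinite set of real numbers, all simple. Let $\varphi(x,\lambda)$ and $\psi(x,\lambda)$ be the solutions of the equation with $\varphi(0,\lambda)=1$, $\varphi'(0,\lambda)=h$ and $\psi(0,\lambda)=1$, $\psi'(0,\lambda)=\widetilde h$. Define $$\Phi(\lambda):=\lambda(\varphi'(\pi,\lambda)+H\varphi(\pi,\lambda))-H_1\varphi'(\pi,\lambda)-H_2\varphi(\pi,\lambda),$$ $$\Psi(\lambda):=\lambda(\psi'(\pi,\lambda)+H\psi(\pi,\lambda))-H_1\psi'(\pi,\lambda)-H_2\psi(\pi,\lambda);$$ the zeros of $\Phi$ and $\Psi$ are the eigenvalues $\lambda_n$ and $\mu_n$, respectively. The norming constants of $\mathcal{P}(q,h,H,H_1,H_2)$ are $$\gamma_n:=\int_0^\pi\varphi^2(x,\lambda_n)\,dx+\frac{(\varphi'(\pi,\lambda_n)+H\varphi(\pi,\lambda_n))^2}{\rho}.$$ *)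

(* Defs.v *)
From HB Require Import structures.
From mathcomp Require Import all_boot all_order all_algebra.
From mathcomp Require Import all_classical all_reals all_analysis.
Set Implicit Arguments.
Unset Strict Implicit.
Unset Printing Implicit Defensive.
Import Order.TTheory GRing.Theory Num.Theory.
Import numFieldNormedType.Exports.
Local Open Scope classical_set_scope.
Local Open Scope ring_scope.

Section SturmLiouville.
Context {R : realType}.
Implicit Types (q f g y dy : R -> R) (l h H : R) (phi dphi : R -> R -> R).

Local Notation mu := (@lebesgue_measure R).

Definition inL2 q : Prop :=
  measurable_fun `[0, pi]%classic q /\
  mu.-integrable `[0, pi]%classic (fun x => (q x ^+ 2)%:E).

(* Absolute continuity on [0, pi]: f is the indefinite Lebesgue integral of its
   (almost everywhere defined) derivative g. *)
Definition ac_with_derivative f g : Prop :=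
  mu.-integrable `[0, pi]%classic (EFin \o g) /\
  forall x, 0 <= x <= pi -> f x = f 0 + \int[mu]_(t in `[0, x]) g t.

(* y and y' = dy are absolutely continuous on [0, pi] and -y'' + q y = l y holds
   almost everywhere.  As dy is continuous, it is the classical derivative of y
   (one-sided at 0 and pi), so dy 0 and dy pi are y'(0) and y'(pi). *)
Definition sl_solution q l y dy : Prop :=
  ac_with_derivative y dy /\
  exists d2y : R -> R, ac_with_derivative dy d2y /\
    {ae mu, forall x, 0 <= x <= pi -> - d2y x + q x * y x = l * y x}.

(* The spectral parameter is real: the boundary value problem is self-adjoint
   when H * H1 - H2 > 0, and all its eigenvalues are real. *)
Definition sl_eigenvalue q h (H H1 H2 : R) l : Prop :=
  exists y dy : R -> R,
    [/\ sl_solution q l y dy,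
        exists2 x, 0 <= x <= pi & y x != 0,
        dy 0 - h * y 0 = 0 &
        l * (dy pi + H * y pi) = H1 * dy pi + H2 * y pi].

(* phi l x and dphi l x stand for phi(x, l) and d/dx phi(x, l). *)
Definition normalized_solutions q h phi dphi : Prop :=
  forall l, [/\ sl_solution q l (phi l) (dphi l), phi l 0 = 1 & dphi l 0 = h].

Definition charfun (H H1 H2 : R) phi dphi l : R :=
  l * (dphi l pi + H * phi l pi) - H1 * dphi l pi - H2 * phi l pi.

Definition norming_constant (H H1 H2 : R) phi dphi l : R :=
  \int[mu]_(x in `[0, pi]) (phi l x ^+ 2)
  + (dphi l pi + H * phi l pi) ^+ 2 / (H * H1 - H2).

Definition increasing_enumeration (E : R -> Prop) (e : nat -> R) : Prop :=
  (forall n, e n < e n.+1) /\ (forall l, E l <-> exists n, l = e n).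

End SturmLiouville.

(* Main.v *)
Require Import Defs.
From HB Require Import structures.
From mathcomp Require Import all_boot all_order all_algebra.
From mathcomp Require Import all_classical all_reals all_analysis.
From mathcomp Require Import measurable_realfun ring lra.
Set Implicit Arguments.
Unset Strict Implicit.
Unset Printing Implicit Defensive.
Import Order.TTheory GRing.Theory Num.Theory.
Import numFieldNormedType.Exports.
Local Open Scope classical_set_scope.
Local Open Scope ring_scope.

(** Everything comes from the Lagrange identity
    [(y z' - y' z)(x) = (y z' - y' z)(0) + (l - m) * \int_0^x y z] for solutions [y], [z]
    at the spectral parameters [l], [m].  It gives uniqueness for the initial value
    problem, and through variation of constants a Lipschitz dependence of
    [phi(., m)] on [m].  With [rho = H H1 - H2] and [k = phi'(pi, l) + H phi(pi, l)]
    at a zero [l] of [Phi], the boundary condition yields [k Psi(l) = rho (h - ht)] and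
    [Phi(m) = (m - l) (k_m + (rho / k) \int phi(., l) phi(., m))],
    [k_m = phi'(pi, m) + H phi(pi, m)]; letting [m] tend to [l] gives the formula for
    the norming constant.  Consequently [Phi' Psi < 0] at the zeros of [Phi] and, by
    symmetry, [Psi' Phi > 0] at the zeros of [Psi], so each function vanishes between
    consecutive zeros of the other.  The smallest zero belongs to [Phi] because both
    functions are negative near [-oo]. *)

(** * Fubini's theorem for real-valued integrals and integration over triangles *)

Section fubini.
Context {R : realType}.
Local Notation leb := (@lebesgue_measure R).

(** Integrability of every section, rather than almost every one, makes all inner integrals finite,
    so the extended-real Fubini theorem transfers to [Rintegral]. *)
Lemma Rintegral_Fubini (f : R -> R -> R) :
  (leb \x leb)%E.-integrable setT (fun z => (f z.1 z.2)%:E) ->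
  (forall x, leb.-integrable setT (EFin \o f x)) ->
  (forall y, leb.-integrable setT (EFin \o f ^~ y)) ->
  leb.-integrable setT (EFin \o (fun x => \int[leb]_y f x y)) /\
  \int[leb]_x (\int[leb]_y f x y) = \int[leb]_y (\int[leb]_x f x y).
Proof.
move=> fi f1 f2.
have e1 x : ((\int[leb]_y f x y)%:E = \int[leb]_y (f x y)%:E)%E.
  by rewrite /Rintegral fineK//; apply: integrable_fin_num => //; exact: f1.
have e2 y : ((\int[leb]_x f x y)%:E = \int[leb]_x (f x y)%:E)%E.
  by rewrite /Rintegral fineK//; apply: integrable_fin_num => //; exact: f2.
split.
- apply: eq_integrable (integrable_fubini_F fi) => // x _.
  by rewrite /= e1.
- rewrite [LHS]/Rintegral [RHS]/Rintegral; congr fine.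
  under eq_integral do rewrite e1.
  under [RHS]eq_integral do rewrite e2.
  exact: Fubini fi.
Qed.

Lemma integrable_mul_bool d (T : measurableType d) (m : {measure set T -> \bar R})
    (a : T -> R) (P : T -> bool) :
  measurable_fun setT P -> m.-integrable setT (EFin \o a) ->
  m.-integrable setT (EFin \o (fun t => a t * (P t)%:R)).
Proof.
move=> mP ia.
have [/measurable_EFinP ma _] := integrableP _ _ _ ia.
have e : (fun t => a t * (P t)%:R) = (fun t => if P t then a t else 0).
  by apply/funext => t; case: (P t); rewrite ?mulr1 ?mulr0.
apply: le_integrable ia => //.
  by rewrite e; apply/measurable_EFinP; apply: measurable_fun_ifT.
move=> t _ /=; rewrite lee_fin normrM ler_piMr//.
by case: (P t); rewrite ?normr1 ?normr0.
Qed.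

(** By Tonelli, the iterated integral of [|a x| * |b y|] is the product of two finite L1 norms. *)
Lemma integrable_prod (a b : R -> R) :
  leb.-integrable setT (EFin \o a) -> leb.-integrable setT (EFin \o b) ->
  (leb \x leb)%E.-integrable setT (EFin \o (fun z : R * R => a z.1 * b z.2)).
Proof.
move=> ia ib.
have [/measurable_EFinP ma la] := integrableP _ _ _ ia.
have [/measurable_EFinP mb lb] := integrableP _ _ _ ib.
apply/integrable12ltyP => /=.
  apply/measurable_EFinP; apply: measurable_funM.
    by apply: measurableT_comp => //; exact: measurable_fst.
  by apply: measurableT_comp => //; exact: measurable_snd.
under eq_integral.
  move=> x _; under eq_integral do rewrite normrM EFinM.
  rewrite ge0_integralZl//; last first.
    by apply: measurableT_comp => //; exact: measurableT_comp.
  over.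
rewrite /=.
have -> : (\int[leb]_y `|b y|%:E)%E = (fine (\int[leb]_y `|b y|%:E)%E)%:E.
  rewrite fineK// ge0_fin_numE//; exact: integral_ge0.
rewrite ge0_integralZr//.
- rewrite lte_mul_pinfty//; [exact: integral_ge0| |exact: ltry].
  by rewrite ge0_fin_numE//; exact: integral_ge0.
- by apply/measurable_EFinP; exact: measurableT_comp.
- by rewrite lee_fin fine_ge0//; exact: integral_ge0.
Qed.

(* The two iterated integrals run over the triangles [s <= t] and [t <= s], which overlap in
   a null set. *)
Lemma Rintegral_triangles (a b : R -> R) :
  leb.-integrable setT (EFin \o a) -> leb.-integrable setT (EFin \o b) ->
  \int[leb]_t ((\int[leb]_s (a s * (s <= t)%R%:R)) * b t) +
  \int[leb]_s (a s * (\int[leb]_t (b t * (t <= s)%R%:R))) =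
  (\int[leb]_s a s) * (\int[leb]_t b t).
Proof.
move=> ia ib.
have mle1 (s : R) : measurable_fun setT (fun t : R => s <= t).
  exact: measurable_fun_ler.
have mle2 (s : R) : measurable_fun setT (fun t : R => t <= s).
  exact: measurable_fun_ler.
have ia2 t := @integrable_mul_bool _ _ leb a (fun s => s <= t) (mle2 t) ia.
have ib1 t := @integrable_mul_bool _ _ leb b (fun s => t <= s) (mle1 t) ib.
have ib2 t := @integrable_mul_bool _ _ leb b (fun s => s <= t) (mle2 t) ib.
pose f s t := a s * b t * (s <= t)%R%:R.
have fi : (leb \x leb)%E.-integrable setT (fun z => (f z.1 z.2)%:E).
  apply: (@integrable_mul_bool _ _ (leb \x leb)%E _
    (fun z => z.1 <= z.2) _ (integrable_prod ia ib)).
  by apply: measurable_fun_ler; [exact: measurable_fst | exact: measurable_snd].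
have f1 x : leb.-integrable setT (EFin \o f x).
  apply: eq_integrable (integrableZl measurableT (a x) (ib1 x)) => // t _.
  by rewrite /f /= -EFinM mulrA.
have f2 y : leb.-integrable setT (EFin \o f ^~ y).
  apply: eq_integrable (integrableZl measurableT (b y) (ia2 y)) => // t _.
  by rewrite /f /= -EFinM mulrCA mulrA.
have [iF eF] := @Rintegral_Fubini f fi f1 f2.
have -> : \int[leb]_t ((\int[leb]_s (a s * (s <= t)%R%:R)) * b t) =
    \int[leb]_x (\int[leb]_y f x y).
  rewrite eF; apply: eq_Rintegral => t _.
  rewrite mulrC -RintegralZl//.
  by apply: eq_Rintegral => s _; rewrite /f mulrCA mulrA.
have -> : \int[leb]_s (a s * (\int[leb]_t (b t * (t <= s)%R%:R))) =
    \int[leb]_s (a s * (\int[leb]_t b t) - \int[leb]_y f s y).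
  apply: eq_Rintegral => s _.
  have -> : \int[leb]_y f s y = a s * \int[leb]_y (b y * (s <= y)%R%:R).
    rewrite -RintegralZl//.
    by apply: eq_Rintegral => y _; rewrite /f mulrA.
  rewrite -mulrBr -RintegralB//.
  congr (_ * _); rewrite /Rintegral; congr fine.
  apply: ae_eq_integral => //.
  - exact: measurable_int (ib2 s).
  - apply: measurable_int (_ : leb.-integrable _ _).
    apply: eq_integrable (integrableB measurableT ib (ib1 s)) => //.
  exists [set s]; split => //; first exact: lebesgue_measure_set1.
  move=> t /= Ht; apply: contrapT => nts; apply: Ht => _; congr EFin.
  case: (ltgtP t s) => [ts|ts|//]; first by rewrite mulr1 mulr0 subr0.
  by rewrite mulr1 mulr0 subrr.
rewrite RintegralB//.
- by rewrite RintegralZr// addrC subrK.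
- apply: eq_integrable (integrableZl measurableT (\int[leb]_t b t) ia) => // t _.
  by rewrite /= -EFinM mulrC.
Qed.
End fubini.

(** * Absolutely continuous functions on [[0, pi]] *)

Section absolute_continuity.
Context {R : realType}.
Local Notation leb := (@lebesgue_measure R).
Local Notation L1 x g := (leb.-integrable `[0, x]%classic (EFin \o g)).
Implicit Types (f g : R -> R) (x c : R).

Lemma L1_sub x g : 0 <= x <= pi -> L1 pi g -> L1 x g.
Proof.
move=> /andP[x0 xpi]; apply: integrableS => //.
by apply: subset_itvl; rewrite bnd_simp.
Qed.

Lemma L1_cst x c : L1 x (fun=> c).
Proof.
apply: continuous_compact_integrable; first exact: segment_compact.
by apply: continuous_subspaceT => t; exact: cvg_cst.
Qed.

Lemma L1D x f g : L1 x f -> L1 x g -> L1 x (fun t => f t + g t).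
Proof.
move=> i j; apply: eq_integrable (integrableD _ i j) => //.
Qed.

Lemma L1Z x c f : L1 x f -> L1 x (fun t => c * f t).
Proof. by move=> i; apply: eq_integrable (integrableZl _ c i). Qed.

Lemma L1_norm x f : L1 x f -> L1 x (fun t => `|f t|).
Proof. by move=> i; apply: eq_integrable (integrable_norm i). Qed.

(** Serves to replace the second derivative of a solution by the expression that the differential
    equation prescribes almost everywhere. *)
Lemma ac_eq_ae f g1 g2 : {ae leb, forall x, 0 <= x <= pi -> g1 x = g2 x} ->
  L1 pi g2 -> ac_with_derivative f g1 -> ac_with_derivative f g2.
Proof.
move=> eg i2 [i1 fE]; split=> // x x0; rewrite fE//; congr (_ + _).
rewrite /Rintegral; congr fine; apply: ae_eq_integral => //.
- exact: measurable_int (L1_sub x0 i1).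
- exact: measurable_int (L1_sub x0 i2).
- have [N [mN N0 sN]] := eg; exists N; split=> // t Ht; apply: sN => H.
  apply: Ht => /=; rewrite in_itv /= => /andP[t0 tx].
  by rewrite H// t0 (le_trans tx)//; case/andP: x0.
Qed.

Lemma acD f1 f2 g1 g2 : ac_with_derivative f1 g1 -> ac_with_derivative f2 g2 ->
  ac_with_derivative (fun x => f1 x + f2 x) (fun x => g1 x + g2 x).
Proof.
move=> [i1 e1] [i2 e2]; split; first exact: L1D.
move=> x x0; rewrite e1// e2// RintegralD//; last 2 first.
- exact: L1_sub i1.
- exact: L1_sub i2.
by rewrite addrACA.
Qed.

Lemma acZ c f g : ac_with_derivative f g ->
  ac_with_derivative (fun x => c * f x) (fun x => c * g x).
Proof.
move=> [i1 e1]; split; first exact: L1Z.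
move=> x x0; rewrite e1// RintegralZl//; last exact: L1_sub i1.
by rewrite mulrDr.
Qed.

Lemma ac_bounded f g : ac_with_derivative f g ->
  exists2 M, 0 < M & forall x, 0 <= x <= pi -> `|f x| <= M.
Proof.
move=> [i e]; exists (`|f 0| + \int[leb]_(t in `[0, pi]) `|g t| + 1).
  by rewrite ltr_wpDl// addr_ge0//; apply: Rintegral_ge0.
move=> x x0; rewrite e// (le_trans (ler_normD _ _))// -addrA lerD2l.
have ix := L1_sub x0 i.
rewrite (le_trans (le_normr_Rintegral _ ix))//.
apply: (@le_trans _ _ (\int[leb]_(t in `[0, pi]) `|g t|)); last by rewrite lerDl.
rewrite /Rintegral fine_le//.
- by apply: integrable_fin_num => //; exact: L1_norm.
- by apply: integrable_fin_num => //; exact: L1_norm.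
- apply: ge0_subset_integral => //.
    by apply: measurable_int (L1_norm i).
  by apply: subset_itvl; rewrite bnd_simp; case/andP: x0.
Qed.

Lemma ac_continuous f g : ac_with_derivative f g ->
  {within `[0, pi], continuous f}.
Proof.
move=> [i e].
have pi0 : 0 <= pi :> R by exact: pi_ge0.
have := parameterized_integral_continuous pi0 i.
move=> ci.
apply: (@subspace_eq_continuous _ _ _ (fun x => f 0 + parameterized_integral leb 0 x g)).
  by move=> x; rewrite inE /= in_itv /= => x0; rewrite -[RHS]/(f x) (e x).
move=> x; apply: cvgD; first exact: cvg_cst.
exact: ci.
Qed.

Lemma ac_measurable f g : ac_with_derivative f g ->
  measurable_fun (`[0, pi]%classic : set R) f.
Proof.
move=> /ac_continuous; apply: subspace_continuous_measurable_fun.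
exact: measurable_itv.
Qed.

Lemma L1_acM f g h : ac_with_derivative f g -> L1 pi h ->
  L1 pi (fun x => f x * h x).
Proof.
move=> af ih.
have [M M0 fM] := ac_bounded af.
apply: eq_integrable (integrableMr _ _ _ ih) => //.
- exact: ac_measurable af.
- exists M; split; first by rewrite realE ltW.
  move=> y My t /=; rewrite in_itv /= => t0.
  by rewrite (le_trans (fM _ t0))// ltW.
Qed.

Lemma ac_L1 f g : ac_with_derivative f g -> L1 pi f.
Proof.
move=> af; apply: eq_integrable (L1_acM af (L1_cst pi 1)) => // t _.
by rewrite /= mulr1.
Qed.

(** Fubini for [g1 s * g2 t] on the square over [[0, x]]: the inner integrals over the two triangles
    are [f1 t - f1 0] and [f2 s - f2 0], and the whole square gives the product of the increments of
    [f1] and [f2]. *)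
Lemma acM f1 f2 g1 g2 : ac_with_derivative f1 g1 -> ac_with_derivative f2 g2 ->
  ac_with_derivative (fun x => f1 x * f2 x)
    (fun x => f1 x * g2 x + g1 x * f2 x).
Proof.
move=> a1 a2; have [i1 e1] := a1; have [i2 e2] := a2.
have i12 := L1_acM a1 i2.
have i21 : L1 pi (fun x => g1 x * f2 x).
  by apply: eq_integrable (L1_acM a2 i1) => // t _; rewrite /= mulrC.
split; first exact: L1D.
move=> x x0; have /andP[x0' xpi] := x0.
pose D : set R := `[0, x]%classic.
have ix g : L1 pi g -> leb.-integrable setT (EFin \o (g \_ D)).
  move=> ig; rewrite -restrict_EFin.
  apply: (iffLR (integrable_mkcond _ _)); first exact: measurable_itv.
  exact: L1_sub ig.
have part g f t : D t -> (forall x, 0 <= x <= pi ->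
    f x = f 0 + \int[leb]_(t in `[0, x]) g t) ->
    \int[leb]_s ((g \_ D) s * (s <= t)%R%:R) = f t - f 0.
  rewrite /D /= in_itv /= => /andP[t0 tx] fE.
  rewrite [in RHS]fE ?t0 ?(le_trans tx)// addrAC subrr add0r.
  rewrite [RHS]Rintegral_mkcond; apply: eq_Rintegral => s _.
  rewrite /patch !mem_setE !in_itv /=.
  case: (leP s t) => st; rewrite ?(andbT, andbF, mulr1, mulr0)//.
  by rewrite (le_trans st tx) andbT.
have := Rintegral_triangles (ix _ i1) (ix _ i2).
rewrite -!Rintegral_mkcond.
have -> : \int[leb]_t ((\int[leb]_s ((g1 \_ D) s * (s <= t)%R%:R)) * (g2 \_ D) t) =
   \int[leb]_(t in D) (f1 t * g2 t - f1 0 * g2 t).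
  rewrite [RHS]Rintegral_mkcond; apply: eq_Rintegral => t _.
  rewrite /patch; case: ifPn => [|_]; last by rewrite mulr0.
  by rewrite inE => Dt; rewrite (part _ f1)// mulrBl.
have -> : \int[leb]_s ((g1 \_ D) s * \int[leb]_t ((g2 \_ D) t * (t <= s)%R%:R)) =
   \int[leb]_(t in D) (g1 t * f2 t - f2 0 * g1 t).
  rewrite [RHS]Rintegral_mkcond; apply: eq_Rintegral => t _.
  rewrite /patch; case: ifPn => [|_]; last by rewrite mul0r.
  by rewrite inE => Dt; rewrite (part _ f2)// mulrBr (mulrC _ (f2 0)).
have sub := L1_sub x0.
have mD : measurable D by exact: measurable_itv.
rewrite RintegralB//; [|exact: sub|exact/sub/L1Z].
rewrite RintegralB//; [|exact: sub|exact/sub/L1Z].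
rewrite RintegralZl//; [|exact: sub].
rewrite RintegralZl//; [|exact: sub].
rewrite RintegralD//; [|exact: sub|exact: sub].
rewrite (e1 x)// (e2 x)//.
rewrite -/D => E; rewrite mulrDl !mulrDr -E; ring.
Qed.

Lemma ac_expR c : ac_with_derivative (fun x => expR (c * x)) (fun x => c * expR (c * x)).
Proof.
have ce : continuous (fun x : R => expR (c * x)).
  move=> x; apply: continuous_comp; last exact: continuous_expR.
  exact: mulrl_continuous.
have cce : continuous (fun x : R => c * expR (c * x)).
  move=> x; apply: cvgM; [exact: cvg_cst|exact: ce].
split.
  apply: continuous_compact_integrable; first exact: segment_compact.
  exact: continuous_subspaceT.
(* The fundamental theorem of calculus is applied on a nondegenerate interval, so [x = 0] is treated
   apart. *)
move=> x /andP[]; rewrite le_eqVlt => /predU1P[<- _|x0 xpi].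
  by rewrite set_itv1 Rintegral_set1 addr0.
have d (t : R) : is_derive t 1 (fun x : R => expR (c * x)) (c * expR (c * t)).
  apply: is_derive_eq; rewrite /GRing.scale /=; ring.
rewrite /Rintegral (@continuous_FTC2 _ _ (fun x => expR (c * x)))//=.
- by rewrite addrCA subrr addr0.
- exact: continuous_subspaceT.
- split => //.
  + by apply: cvg_at_right_filter; exact: ce.
  + by apply: cvg_at_left_filter; exact: ce.
- by move=> t _; rewrite derive1E derive_val.
Qed.

End absolute_continuity.

(** * Integral estimates, a priori bounds and differentiation at a zero *)

Section bounds.
Context {R : realType}.
Local Notation leb := (@lebesgue_measure R).
Local Notation L1 x g := (leb.-integrable `[0, x]%classic (EFin \o g)).

(** Integrating the majorant over all of [[0, pi]] makes the bound uniform in [x]. *)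
Lemma norm_Rintegral_le (u v : R -> R) (x : R) : 0 <= x <= pi ->
  L1 pi u -> L1 pi v -> (forall t, 0 <= t <= x -> `|u t| <= v t) ->
  (forall t, 0 <= v t) ->
  `|\int[leb]_(t in `[0, x]) u t| <= \int[leb]_(t in `[0, pi]) v t.
Proof.
move=> x0 iu iv uv v0; have /andP[x0' xpi] := x0.
rewrite (le_trans (le_normr_Rintegral _ (L1_sub x0 iu)))//.
apply: (@le_trans _ _ (\int[leb]_(t in `[0, x]) v t)).
  apply: le_Rintegral => //.
    exact/L1_norm/L1_sub/iu.
  exact: L1_sub iv.
rewrite /Rintegral fine_le//.
- by apply: integrable_fin_num => //; exact: L1_sub iv.
- by apply: integrable_fin_num.
- apply: ge0_subset_integral => //; first exact: measurable_int iv.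
    by move=> t _; rewrite lee_fin.
  by apply: subset_itvl; rewrite bnd_simp.
Qed.

Lemma Rintegral_cst_itv0pi (c : R) : \int[leb]_(_ in `[0, pi]) c = c * pi.
Proof.
rewrite Rintegral_cst//= lebesgue_measure_itv/= lte_fin pi_gt0/=.
by rewrite oppr0 addr0.
Qed.

(** The supremum [S] of [|f|] is finite by the first hypothesis, and the second one at [B = S] gives
    [S <= M + S / 2]. *)
Lemma bound_of_halving (f : R -> R) (a b M : R) : 
  (exists B, forall x, a <= x <= b -> `|f x| <= B) ->
  (forall B, (forall x, a <= x <= b -> `|f x| <= B) ->
     forall x, a <= x <= b -> `|f x| <= M + B / 2) ->
  forall x, a <= x <= b -> `|f x| <= 2 * M.
Proof.
move=> [B0 fB0] half x x0.
pose S := [set `|f y| | y in [set y | a <= y <= b]].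
have S0 : S !=set0 by exists `|f x|, x.
have SB : has_sup S by split => //; exists B0 => _ [y y0 <-]; exact: fB0.
have fS y : a <= y <= b -> `|f y| <= sup S.
  by move=> y0; apply: (sup_upper_bound SB); exists y.
have : sup S <= M + sup S / 2.
  by apply: ge_sup => // _ [y y0 <-]; exact: half.
by have := fS _ x0; lra.
Qed.

Lemma cvg_of_lipschitz (f : R -> R) (l C e : R) : 0 < e ->
  (forall m, `|m - l| < e -> `|f m - f l| <= C * `|m - l|) ->
  {for l, continuous f}.
Proof.
move=> e0 fC; apply/cvgrPdist_le => /= d d0.
have C0 : 0 < `|C| + 1 by rewrite ltr_wpDl.
near=> m.
have ml : `|m - l| < e.
  by rewrite distrC; near: m; apply: cvgr_dist_lt => //; exact: cvg_id.
rewrite distrC (le_trans (fC _ ml))//.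
have : `|m - l| < d / (`|C| + 1).
  by rewrite distrC; near: m; apply: cvgr_dist_lt; [exact: cvg_id|rewrite divr_gt0].
rewrite ltr_pdivlMr// => H.
rewrite (le_trans _ (ltW H))// mulrC ler_wpM2l//.
by rewrite (le_trans (ler_norm _))// lerDl.
Unshelve. all: by end_near. Qed.

(** Since [F l = 0], the difference quotient of [F] at [l] is [G] itself. *)
Lemma is_derive_factor (F G : R -> R) (l : R) :
  (forall m, F m = (m - l) * G m) -> {for l, continuous G} ->
  is_derive l 1 F (G l).
Proof.
move=> FG cG.
have c : (fun t => t^-1 *: ((F \o shift l) (t *: (1:R)) - F l)) @ 0^' --> G l.
  have -> : F l = 0 by rewrite FG subrr mul0r.
  apply: cvg_trans (_ : (fun t => G (t + l)) @ 0^' --> G l).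
    apply: near_eq_cvg; near=> t.
    rewrite /= subr0 /GRing.scale /= FG mulr1 addrK mulKf//.
    by near: t; exact: nbhs_dnbhs_neq.
  apply: (@cvg_comp _ _ _ (fun t => t + l) G _ (nbhs l)); last exact: cG.
  have : t + l @[t --> (0 : R)^'] --> 0 + l.
    by apply: cvgD; [exact: nbhs_dnbhs|exact: cvg_cst].
  by rewrite add0r.
have d : derivable F l 1 by apply/cvg_ex; exists (G l).
apply: DeriveDef => //; apply: cvg_lim => //.
Unshelve. all: by end_near. Qed.

End bounds.

(** * Solutions of the Sturm-Liouville equation and their dependence on the spectral parameter *)

Section sturm_liouville.
Context {R : realType}.
Local Notation leb := (@lebesgue_measure R).
Local Notation L1 x g := (leb.-integrable `[0, x]%classic (EFin \o g)).

(** The interval is bounded and [|q| <= 1 + q ^+ 2]. *)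
Lemma inL2_L1 (q : R -> R) : inL2 q -> L1 pi q.
Proof.
move=> [mq iq2]; apply: le_integrable (L1D (L1_cst pi 1) iq2) => //.
  exact/measurable_EFinP.
move=> x _ /=; rewrite lee_fin [leRHS]ger0_norm; last by rewrite addr_ge0 ?sqr_ge0.
by rewrite ler_norml; nra.
Qed.

Section fixed_potential.
Variables (q : R -> R).
Hypothesis iq : L1 pi q.

(** With the second derivative fixed as [(q x - l) * y x] at every point, later identities between
    integrands hold pointwise. *)
Lemma sl_solution_ac l y dy : sl_solution q l y dy ->
  ac_with_derivative y dy /\ ac_with_derivative dy (fun x => (q x - l) * y x).
Proof.
move=> [ay [d2y [ady e]]]; split=> //.
apply: ac_eq_ae ady.
  have [N [mN N0 sN]] := e; exists N; split=> // t Ht; apply: sN => H.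
  by apply: Ht => /H; lra.
have i := L1_acM ay (L1D iq (L1_cst pi (- l))).
by apply: eq_integrable i => // t _; rewrite /= mulrC.
Qed.

(** In the derivative of [y * dz - dy * z] the terms with [dy * dz] and with [q] cancel, which
    leaves [(l - m) * y * z]. *)
Lemma sl_wronskian l m y dy z dz x :
  sl_solution q l y dy -> sl_solution q m z dz -> 0 <= x <= pi ->
  y x * dz x - dy x * z x =
  y 0 * dz 0 - dy 0 * z 0 + (l - m) * \int[leb]_(t in `[0, x]) (y t * z t).
Proof.
move=> /sl_solution_ac[ay ady] /sl_solution_ac[az adz] x0.
have [_ /(_ x x0)] := acD (acM ay adz) (acZ (-1) (acM ady az)).
rewrite !mulN1r => ->; congr (_ + _).
rewrite -RintegralZl//; last exact/L1_sub/L1_acM/(ac_L1 az)/ay.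
by apply: eq_Rintegral => t _; ring.
Qed.

Lemma sl_wronskian_cst l y dy z dz x :
  sl_solution q l y dy -> sl_solution q l z dz -> 0 <= x <= pi ->
  y x * dz x - dy x * z x = y 0 * dz 0 - dy 0 * z 0.
Proof. by move=> sy sz x0; rewrite (sl_wronskian sy sz x0) subrr mul0r addr0. Qed.

Section two_solutions.
Variables (h ht : R) (phi dphi psi dpsi : R -> R -> R).
Hypotheses (hht : h != ht) (nphi : normalized_solutions q h phi dphi)
  (npsi : normalized_solutions q ht psi dpsi).

Lemma wronskian_phi_psi l x : 0 <= x <= pi ->
  phi l x * dpsi l x - dphi l x * psi l x = ht - h.
Proof.
move=> x0; have [s1 p1 d1] := nphi l; have [s2 p2 d2] := npsi l.
by rewrite (sl_wronskian_cst s1 s2 x0) p1 d1 p2 d2 mul1r mulr1.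
Qed.

(** The constant Wronskians of [y] with [phi l] and with [psi l] form a linear system for
    [(y x, dy x)] of determinant [ht - h], up to sign; Cramer's rule solves it. *)
Lemma sl_solution_unique l y dy : sl_solution q l y dy -> dy 0 - h * y 0 = 0 ->
  forall x, 0 <= x <= pi -> y x = y 0 * phi l x /\ dy x = y 0 * dphi l x.
Proof.
move=> sy y0 x x0; have [s1 p1 d1] := nphi l; have [s2 p2 d2] := npsi l.
have W := wronskian_phi_psi l x0.
have W1 := sl_wronskian_cst sy s1 x0; have W2 := sl_wronskian_cst sy s2 x0.
move: W1 W2; rewrite p1 d1 p2 d2 => W1 W2.
have D0 : ht - h != 0 by rewrite subr_eq0 eq_sym.
split; apply: (mulIf D0).
- transitivity (phi l x * (y x * dpsi l x - dy x * psi l x)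
    - psi l x * (y x * dphi l x - dy x * phi l x)).
    by rewrite -W; ring.
  by rewrite W1 W2; have -> : dy 0 = h * y 0 by [lra]; ring.
- transitivity (dphi l x * (y x * dpsi l x - dy x * psi l x)
    - dpsi l x * (y x * dphi l x - dy x * phi l x)).
    by rewrite -W; ring.
  by rewrite W1 W2; have -> : dy 0 = h * y 0 by [lra]; ring.
Qed.

(** By uniqueness an eigenfunction is [y 0] times [phi l], with [y 0 != 0], so its condition at [pi]
    is that of [phi l]. *)
Lemma sl_eigenvalueP H H1 H2 l :
  sl_eigenvalue q h H H1 H2 l <-> charfun H H1 H2 phi dphi l = 0.
Proof.
have pi0 : 0 <= (pi : R) <= pi by rewrite pi_ge0 lexx.
rewrite /charfun; split.
- move=> [y [dy [sy [x x0 yx] bc0 bcpi]]].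
  have U := sl_solution_unique sy bc0.
  have y0 : y 0 != 0.
    by apply: contra yx => /eqP yy; rewrite (U x x0).1 yy mul0r.
  move: bcpi; rewrite (U _ pi0).1 (U _ pi0).2 => bcpi.
  by apply: (mulfI y0); rewrite mulr0; lra.
- move=> E; exists (phi l), (dphi l); have [s p d] := nphi l; split => //.
  + by exists 0; [rewrite lexx pi_ge0 | rewrite p oner_neq0].
  + by rewrite p d; ring.
  + by lra.
Qed.

(** Cramer's rule again, now for the Lagrange identities of [phi m] against [phi l] and [psi l]. *)
Lemma sl_variation_of_constants l m x : 0 <= x <= pi ->
  let I1 := \int[leb]_(t in `[0, x]) (phi l t * phi m t) in
  let I2 := \int[leb]_(t in `[0, x]) (psi l t * phi m t) in
  (ht - h) * (phi m x - phi l x) = (l - m) * (psi l x * I1 - phi l x * I2) /\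
  (ht - h) * (dphi m x - dphi l x) = (l - m) * (dpsi l x * I1 - dphi l x * I2).
Proof.
move=> x0 I1 I2; have [s1 p1 d1] := nphi l; have [s2 p2 d2] := npsi l.
have [s3 p3 d3] := nphi m.
have W := wronskian_phi_psi l x0.
have W1 := sl_wronskian s1 s3 x0; have W2 := sl_wronskian s2 s3 x0.
move: W1 W2; rewrite p1 d1 p2 d2 p3 d3 -/I1 -/I2 => W1 W2.
split.
- transitivity (psi l x * (phi l x * dphi m x - dphi l x * phi m x)
    - phi l x * (psi l x * dphi m x - dpsi l x * phi m x) - (ht - h) * phi l x).
    by rewrite -W; ring.
  by rewrite W1 W2; ring.
- transitivity (dpsi l x * (phi l x * dphi m x - dphi l x * phi m x)
    - dphi l x * (psi l x * dphi m x - dpsi l x * phi m x) - (ht - h) * dphi l x).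
    by rewrite -W; ring.
  by rewrite W1 W2; ring.
Qed.


(** In [K], each of the two products in the variation of constants contributes [M * (M * B * pi)],
    and the determinant is divided out. *)
Lemma sl_norm_variation l M m B :
  (forall x, 0 <= x <= pi -> [/\ `|phi l x| <= M, `|dphi l x| <= M,
     `|psi l x| <= M & `|dpsi l x| <= M]) ->
  (forall x, 0 <= x <= pi -> `|phi m x| <= B) ->
  let K := 2 * M ^+ 2 * pi / `|ht - h| in
  forall x, 0 <= x <= pi ->
    `|phi m x - phi l x| <= `|m - l| * K * B /\
    `|dphi m x - dphi l x| <= `|m - l| * K * B.
Proof.
move=> lM mB K x x0.
have D0 : 0 < `|ht - h| by rewrite normr_gt0 subr_eq0 eq_sym.
have [s1 _ _] := nphi l; have [s2 _ _] := npsi l; have [s3 _ _] := nphi m.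
have [a1 _] := sl_solution_ac s1; have [a2 _] := sl_solution_ac s2.
have [a3 _] := sl_solution_ac s3.
have J (f df : R -> R) : ac_with_derivative f df ->
    (forall x, 0 <= x <= pi -> `|f x| <= M) ->
    `|\int[leb]_(t in `[0, x]) (f t * phi m t)| <= M * B * pi.
  move=> af fM; rewrite -Rintegral_cst_itv0pi.
  have M0 : 0 <= M by rewrite (le_trans _ (fM _ x0)).
  have B0 : 0 <= B by rewrite (le_trans _ (mB _ x0)).
  apply: norm_Rintegral_le => //.
  - exact: L1_acM af (ac_L1 a3).
  - exact: L1_cst.
  - move=> t /andP[t0 tx].
    have t0pi : 0 <= t <= pi by rewrite t0 (le_trans tx)//; case/andP: x0.
    by rewrite normrM ler_pM//; [exact: fM|exact: mB].
  - by move=> _; rewrite mulr_ge0.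
have J1 := J _ _ a1 (fun t t0 => let: And4 p _ _ _ := lM t t0 in p).
have J2 := J _ _ a2 (fun t t0 => let: And4 _ _ p _ := lM t t0 in p).
have [V1 V2] := sl_variation_of_constants l m x0.
have [M1 M2 M3 M4] := lM _ x0.
have est (d a b I1 I2 : R) : (ht - h) * d = (l - m) * (a * I1 - b * I2) ->
    `|a| <= M -> `|b| <= M -> `|I1| <= M * B * pi -> `|I2| <= M * B * pi ->
    `|d| <= `|m - l| * K * B.
  move=> E aM bM I1M I2M; rewrite -(ler_pM2l D0) -normrM E normrM distrC.
  have -> : `|ht - h| * (`|m - l| * K * B) =
      `|m - l| * (M * (M * B * pi) + M * (M * B * pi)).
    by rewrite /K; field; rewrite gt_eqF.
  rewrite ler_wpM2l// (le_trans (ler_normB _ _))// !normrM.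
  by rewrite lerD// ler_pM.
by split; [apply: est V1 _ _ _ _|apply: est V2 _ _ _ _].
Qed.

(* For [m] close to [l], variation of constants with respect to [phi l] and [psi l] is a
   contraction, so no Gronwall argument is needed. *)
Lemma sl_lipschitz l : exists C e, 0 < e /\
  forall m x, `|m - l| < e -> 0 <= x <= pi ->
    `|phi m x - phi l x| <= C * `|m - l| /\
    `|dphi m x - dphi l x| <= C * `|m - l|.
Proof.
have D0 : 0 < `|ht - h| by rewrite normr_gt0 subr_eq0 eq_sym.
have [s1 _ _] := nphi l; have [s2 _ _] := npsi l.
have [a1 b1] := sl_solution_ac s1; have [a2 b2] := sl_solution_ac s2.
have [M1 M10 B1] := ac_bounded a1; have [M2 M20 B2] := ac_bounded b1.
have [M3 M30 B3] := ac_bounded a2; have [M4 M40 B4] := ac_bounded b2.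
pose M := M1 + M2 + M3 + M4.
have M0 : 0 < M by rewrite /M !addr_gt0.
have lM x : 0 <= x <= pi -> [/\ `|phi l x| <= M, `|dphi l x| <= M,
     `|psi l x| <= M & `|dpsi l x| <= M].
  move=> x0; move: (B1 _ x0) (B2 _ x0) (B3 _ x0) (B4 _ x0); rewrite /M => *.
  by split; lra.
pose K := 2 * M ^+ 2 * pi / `|ht - h|.
have K0 : 0 < K.
  rewrite /K divr_gt0//; apply: mulr_gt0; last exact: pi_gt0.
  by rewrite mulr_gt0// exprn_gt0.
(* The radius makes [|m - l| * K <= 1 / 2]. Halving then bounds [phi m] by [2 * M], which enters the
   constant as [B]. *)
exists (K * (2 * M)), (2 * K)^-1; split; first by rewrite invr_gt0; lra.
move=> m x ml.
have mlK : `|m - l| * K <= 1 / 2.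
  move: ml; rewrite -[X in _ < X]mul1r ltr_pdivlMr; last by lra.
  by move=> /ltW; rewrite mulrCA; lra.
have [s3 _ _] := nphi m; have [a3 b3] := sl_solution_ac s3.
have mM t : 0 <= t <= pi -> `|phi m t| <= 2 * M.
  apply: bound_of_halving.
    by have [B _ HB] := ac_bounded a3; exists B.
  move=> B HB {}t t0.
  have [H1 _] := sl_norm_variation lM HB t0.
  have [H2 _ _ _] := lM _ t0.
  have B0 : 0 <= B by rewrite (le_trans _ (HB _ t0)).
  have : `|m - l| * K * B <= B / 2 by rewrite (le_trans (ler_wpM2r B0 mlK))//; lra.
  move: H1; rewrite -/K => H1 H3.
  rewrite -(subrK (phi l t) (phi m t)) (le_trans (ler_normD _ _))//.
  by lra.
move=> x0; have -> : K * (2 * M) * `|m - l| = `|m - l| * K * (2 * M) by ring.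
exact: sl_norm_variation lM mM x x0.
Qed.

Lemma sl_continuous_spectral l x : 0 <= x <= pi ->
  {for l, continuous (phi ^~ x)} /\ {for l, continuous (dphi ^~ x)}.
Proof.
move=> x0; have [C [e [e0 L]]] := sl_lipschitz l.
split; apply: (cvg_of_lipschitz e0) => m ml.
- exact: (L m x ml x0).1.
- exact: (L m x ml x0).2.
Qed.

Lemma charfun_continuous H H1 H2 : continuous (charfun H H1 H2 phi dphi).
Proof.
move=> l; have pi0 : 0 <= (pi : R) <= pi by rewrite pi_ge0 lexx.
have [c1 c2] := sl_continuous_spectral l pi0.
apply: cvgB; first apply: cvgB.
- apply: cvgM; first exact: cvg_id.
  apply: cvgD; first exact: c2.
  by apply: cvgM; [exact: cvg_cst|exact: c1].
- by apply: cvgM; [exact: cvg_cst|exact: c2].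
- by apply: cvgM; [exact: cvg_cst|exact: c1].
Qed.

Lemma sl_inner_continuous l :
  {for l, continuous (fun m => \int[leb]_(t in `[0, pi]) (phi l t * phi m t))}.
Proof.
have pi0 : 0 <= (pi : R) <= pi by rewrite pi_ge0 lexx.
have [C [e [e0 L]]] := sl_lipschitz l.
have [s1 _ _] := nphi l; have [a1 _] := sl_solution_ac s1.
have [M M0 B1] := ac_bounded a1.
apply: (@cvg_of_lipschitz _ _ _ (M * C * pi) _ e0) => m ml.
have [s3 _ _] := nphi m; have [a3 _] := sl_solution_ac s3.
have i1 := L1_acM a1 (ac_L1 a1); have i3 := L1_acM a1 (ac_L1 a3).
rewrite -RintegralB//.
have -> : M * C * pi * `|m - l| = \int[leb]_(_ in `[0, pi]) (M * (C * `|m - l|)).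
  by rewrite Rintegral_cst_itv0pi; ring.
apply: norm_Rintegral_le => //.
- have := L1D i3 (L1Z (-1) i1); apply: eq_integrable => // t _.
  by rewrite /= mulN1r.
- exact: L1_cst.
- move=> t t0; rewrite -mulrBr normrM ler_pM//; first exact: B1.
  by have [] := L _ _ ml t0.
- move=> _; rewrite mulr_ge0//; first exact: ltW.
  by have [H _] := L _ _ ml pi0; rewrite (le_trans _ H).
Qed.

(** If [k] were zero, [phi l] and [dphi l] would both vanish at [pi], against the nonzero Wronskian
    with [psi l]. Eliminating [k] from the last two conclusions gives the formula for the norming
    constant. *)
Lemma charfun_at_root H H1 H2 l : 0 < H * H1 - H2 ->
  charfun H H1 H2 phi dphi l = 0 ->
  let k := dphi l pi + H * phi l pi in
  let Phi := charfun H H1 H2 phi dphi in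
  [/\ k != 0, k * charfun H H1 H2 psi dpsi l = (H * H1 - H2) * (h - ht) &
     is_derive l 1 Phi ((H * H1 - H2) / k * norming_constant H H1 H2 phi dphi l)].
Proof.
set rho := H * H1 - H2 => rho0 Pl k Phi.
have rho_neq0 : rho != 0 by rewrite gt_eqF.
have pi0 : 0 <= (pi : R) <= pi by rewrite pi_ge0 lexx.
set a := phi l pi; set b := dphi l pi.
(* The boundary condition at [pi] determines [(a, b)] up to the factor [k / rho]. *)
have aE : rho * a = - (l - H1) * k.
  by move: Pl; rewrite /charfun -/a -/b /rho /k -/a -/b => Pl; lra.
have bE : rho * b = (H * l - H2) * k.
  move: Pl; rewrite /charfun -/a -/b /rho /k -/a -/b => Pl.
  by have := congr1 (fun z => H * z) Pl; rewrite mulr0 => E; lra.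
have W := wronskian_phi_psi l pi0.
have D0 : ht - h != 0 by rewrite subr_eq0 eq_sym.
have k0 : k != 0.
  apply: contra D0 => /eqP k0; rewrite k0 !mulr0 in aE bE.
  move/eqP: aE; rewrite mulf_eq0 (negPf rho_neq0)/= => /eqP a0.
  move/eqP: bE; rewrite mulf_eq0 (negPf rho_neq0)/= => /eqP b0.
  by rewrite -W -/a -/b a0 b0 !mul0r subrr.
split => //.
  transitivity (- (rho * (a * dpsi l pi - b * psi l pi))).
    rewrite [rho * _]mulrBr !(mulrA rho) aE bE /charfun; ring.
  by rewrite W; ring.
pose G m := (dphi m pi + H * phi m pi) +
   rho / k * \int[leb]_(t in `[0, pi]) (phi l t * phi m t).
have [s1 p1 d1] := nphi l.
have FG m : Phi m = (m - l) * G m.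
  have [s3 p3 d3] := nphi m.
  have := sl_wronskian s1 s3 pi0; rewrite p1 d1 p3 d3 -/a -/b => E.
  apply: (mulfI k0); rewrite [RHS]mulrCA [k * G m]mulrDr (mulrA k) (mulrC k (_ / _)) divfK//.
  (* Splitting off the multiple of [m - l] leaves [(l - H1) * dphi m pi + (H * l - H2) * phi m pi];
     multiplied by [k], this is [- rho] times the Wronskian of [phi l] and [phi m] at [pi]. *)
  transitivity (k * (m - l) * (dphi m pi + H * phi m pi)
     - rho * (a * dphi m pi - b * phi m pi)).
    rewrite [rho * (_ - _)]mulrBr !(mulrA rho) aE bE /Phi /charfun; ring.
  by rewrite E; ring.
have -> : rho / k * norming_constant H H1 H2 phi dphi l = G l.
  rewrite /norming_constant /G -/a -/b -/k -/rho.
  have -> : \int[leb]_(x in `[0, pi]) (phi l x ^+ 2) =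
            \int[leb]_(t in `[0, pi]) (phi l t * phi l t).
    by apply: eq_Rintegral => t _; rewrite expr2.
  by field; rewrite rho_neq0 k0.
apply: is_derive_factor FG _.
have [c1 c2] := sl_continuous_spectral l pi0.
apply: cvgD.
  apply: cvgD; first exact: c2.
  by apply: cvgM; [exact: cvg_cst|exact: c1].
by apply: cvgM; [exact: cvg_cst|exact: sl_inner_continuous].
Qed.

(** Strictness comes from the boundary term [k ^+ 2 / rho] with [k != 0]. *)
Lemma norming_constant_gt0 H H1 H2 l : 0 < H * H1 - H2 ->
  charfun H H1 H2 phi dphi l = 0 -> 0 < norming_constant H H1 H2 phi dphi l.
Proof.
move=> rho0 /(charfun_at_root rho0)[k0 _ _].
rewrite /norming_constant ltr_wpDl//.
  by apply: Rintegral_ge0 => t _; exact: sqr_ge0.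
by rewrite divr_gt0// exprn_even_gt0.
Qed.

End two_solutions.
End fixed_potential.
End sturm_liouville.

(** * Sign of the characteristic function near minus infinity *)

Section negative_spectral_parameter.
Context {R : realType}.
Local Notation leb := (@lebesgue_measure R).
Local Notation L1 x g := (leb.-integrable `[0, x]%classic (EFin \o g)).
Variables (q : R -> R).
Hypothesis iq : L1 pi q.
Let Q := \int[leb]_(t in `[0, pi]) `|q t|.

(* With [w = y' + k y] and [v = y' - k y] the equation [y'' = (q + k^2) y] becomes
   [(e^(-kx) w)' = e^(-kx) q y] and [(e^(kx) v)' = e^(kx) q y]. *)
Lemma sl_exp_estimate (k B : R) y dy : 0 < k ->
  sl_solution q (- k ^+ 2) y dy ->
  (forall x, 0 <= x <= pi -> `|expR (- k * x) * y x| <= B) ->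
  forall x, 0 <= x <= pi ->
  `|expR (- k * x) * (dy x + k * y x) - (dy 0 + k * y 0)| <= B * Q /\
  `|expR (- k * x) * (dy x - k * y x)| <=
     expR (- k * x) ^+ 2 * `|dy 0 - k * y 0| + B * Q.
Proof.
move=> k0 /(sl_solution_ac iq)[ay ady] yB x x0.
have B0 : 0 <= B by rewrite (le_trans _ (yB _ x0)).
have aw := acM (ac_expR (- k)) (acD ady (acZ k ay)).
have av := acM (ac_expR k) (acD ady (acZ (- k) ay)).
have iBq : L1 pi (fun t => B * `|q t|) by exact/L1Z/L1_norm.
have Bq0 t : 0 <= B * `|q t| by rewrite mulr_ge0.
have BQ : B * Q = \int[leb]_(t in `[0, pi]) (B * `|q t|).
  by rewrite RintegralZl//; exact: L1_norm.
have EE t : expR (- k * t) * expR (k * t) = 1 :> R.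
  by rewrite -expRD mulNr addNr expR0.
split.
- have [iw /(_ x x0)] := aw; rewrite !mulr0 expR0 mul1r => ->.
  rewrite addrAC subrr add0r BQ; apply: norm_Rintegral_le => //.
  move=> t /andP[t0 tx].
  have t0pi : 0 <= t <= pi by rewrite t0 (le_trans tx)//; case/andP: x0.
  rewrite [X in `|X|](_ : _ = expR (- k * t) * y t * q t); last by ring.
  by rewrite normrM ler_wpM2r//; exact: yB.
- have [iv /(_ x x0)] := av; rewrite !mulr0 expR0 mul1r.
  set J := \int[leb]_(_ in _) _; rewrite 2!(mulNr k) => vE.
  (* The growing weight [expR (k * x)] is traded for the decaying one by a factor
     [expR (- k * x) ^+ 2]. *)
  have -> : expR (- k * x) * (dy x - k * y x) =
      expR (- k * x) ^+ 2 * (dy 0 - k * y 0) + expR (- k * x) ^+ 2 * J.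
    rewrite -mulrDr -vE mulrA expr2 -!mulrA (mulrA (expR (- k * x)) (expR (k * x))) EE.
    ring.
  rewrite (le_trans (ler_normD _ _))// normrM ger0_norm ?exprn_ge0 ?expR_ge0// lerD2l.
  rewrite /J -RintegralZl//; last exact: L1_sub iv.
  rewrite BQ; apply: norm_Rintegral_le => //; first exact: L1Z.
  move=> t /andP[t0 tx].
  have t0pi : 0 <= t <= pi by rewrite t0 (le_trans tx)//; case/andP: x0.
  (* The first factor is [e^(-2k(x - t))], at most 1 because [t <= x]. *)
  rewrite [X in `|X|](_ : _ = (expR (- k * x) * expR (k * t)) ^+ 2 *
     (expR (- k * t) * y t * q t)); last first.
    transitivity (expR (- k * x) ^+ 2 *
      (expR (k * t) * (expR (- k * t) * expR (k * t)) * q t * y t)).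
      by rewrite EE; ring.
    ring.
  rewrite -expRD normrM (le_trans (_ : _ <= 1 * `|expR (- k * t) * y t * q t|))//.
    rewrite ler_wpM2r// ger0_norm ?exprn_ge0 ?expR_ge0// expr_le1 ?expR_ge0//.
    by rewrite -expR0 ler_expR; nra.
  by rewrite mul1r normrM ler_wpM2r//; exact: yB.
Qed.

(** For [l = - k ^+ 2] with [k] large, [dphi l pi] and [k * phi l pi] are both close to
    [k * e^(k pi) / 2] in relative terms, so the term [l * dphi l pi] dominates and is negative. *)
Lemma charfun_lt0 h H H1 H2 phi dphi : normalized_solutions q h phi dphi ->
  exists L, forall l, l < L -> charfun H H1 H2 phi dphi l < 0.
Proof.
move=> nphi.
have Q0 : 0 <= Q by exact: Rintegral_ge0.
(* [C] will bound both [|v|] and [|w - k|]: here 4 bounds [expR (- k * x) * phi l x], and 1 bounds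
   [E ^+ 2 * k]. *)
pose C := `|h| + 1 + 4 * Q.
(* [k > K] exceeds each summand; these are the thresholds of the final comparison. *)
pose K := 1 + 4 * C + 2 * `|H1| + 8 * (`|H| + `|H2|).
have K0 : 1 <= K.
  by rewrite /K /C; move: (normr_ge0 h) (normr_ge0 H1) (normr_ge0 H) (normr_ge0 H2); lra.
exists (- K ^+ 2) => l lK.
pose k := Num.sqrt (- l).
have lk : l = - k ^+ 2.
  by rewrite sqr_sqrtr ?opprK// oppr_ge0 (le_trans (ltW lK))// oppr_le0 sqr_ge0.
have Kk : K < k.
  rewrite -(ltr_pXn2r (n := 2))// ?nnegrE ?sqrtr_ge0//; last by lra.
  by have K2 := sqr_ge0 K; rewrite sqr_sqrtr; lra.
have k1 : 1 < k by lra.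
have k0 : 0 < k by lra.
have [s p d] := nphi l.
have pi0 : 0 <= (pi : R) <= pi by rewrite pi_ge0 lexx.
rewrite lk in s.
have hk : `|h| + 2 * Q <= k.
  move: Kk; rewrite /K /C.
  by move: (normr_ge0 h) (normr_ge0 H1) (normr_ge0 H) (normr_ge0 H2); lra.
have est := sl_exp_estimate k0 s; rewrite -lk p d mulr1 in est.
have hh : `|h + k| <= `|h| + k by rewrite (le_trans (ler_normD _ _))// (gtr0_norm k0).
have hh' : `|h - k| <= `|h| + k by rewrite (le_trans (ler_normB _ _))// (gtr0_norm k0).
(* From a bound [B] the two estimates yield [(2 * (|h| + k) + 2 * B * Q) / (2 * k)], which is at
   most [2 + B / 2] by [hk]. *)
have yB : forall x, 0 <= x <= pi -> `|expR (- k * x) * phi l x| <= 2 * 2.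
  apply: bound_of_halving.
    have [ay ady] := sl_solution_ac iq s.
    have [B _ HB] := ac_bounded (acM (ac_expR (- k)) ay).
    by exists B; rewrite lk.
  move=> B yB x x0; have [E1 E2] := est B yB x x0.
  have B0 : 0 <= B by rewrite (le_trans _ (yB _ x0)).
  set E := expR _ in E1 E2 *.
  have E0 : 0 <= E by exact: expR_ge0.
  have E1' : E <= 1.
    by rewrite /E -expR0 ler_expR; case/andP: x0 => *; nra.
  have E2' : E ^+ 2 * `|h - k| <= `|h| + k.
    by rewrite (le_trans _ hh')// ler_piMl// expr_le1.
  have -> : E * phi l x = (E * (dphi l x + k * phi l x) - E * (dphi l x - k * phi l x)) / (2 * k).
    by field; rewrite gt_eqF.
  rewrite normrM normfV (gtr0_norm (_ : 0 < 2 * k)); last by lra.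
  rewrite ler_pdivrMr; last by lra.
  rewrite (le_trans (ler_normB _ _))//.
  have : `|E * (dphi l x + k * phi l x)| <= B * Q + (`|h| + k).
    rewrite -[X in `|X|](subrK (h + k)) (le_trans (ler_normD _ _))//.
    by rewrite lerD.
  have h0 := normr_ge0 h.
  have BQ2 : B * (2 * Q) <= B * k by rewrite ler_wpM2l//; lra.
  by lra.
have [W V] := est _ yB pi pi0.
set E := expR _ in W V.
have E0 : 0 < E by exact: expR_gt0.
have Ek : E ^+ 2 * k <= 1.
  rewrite /E -expRM_natl.
  have -> : 2%:R * (- k * pi) = - (2 * k * pi) :> R by ring.
  rewrite expRN mulrC ler_pdivrMr ?expR_gt0// mul1r.
  have := expR_ge1Dx (2 * k * pi); have := @pi_ge2 R; nra.
have E1 : E ^+ 2 <= 1 by have := sqr_ge0 E; nra.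
have V' : `|E * (dphi l pi - k * phi l pi)| <= C.
  rewrite (le_trans V)// /C.
  have : E ^+ 2 * `|h - k| <= E ^+ 2 * (`|h| + k) by rewrite ler_wpM2l ?sqr_ge0.
  have : E ^+ 2 * `|h| <= `|h| by rewrite ler_piMl.
  lra.
have W' : `|E * (dphi l pi + k * phi l pi) - k| <= C.
  rewrite [X in `|X|](_ : _ = E * (dphi l pi + k * phi l pi) - (h + k) + h); last by ring.
  by rewrite (le_trans (ler_normD _ _))// /C; lra.
move: V' W'; set v := E * _; set w := E * _; rewrite !ler_norml => /andP[v1 v2] /andP[w1 w2].
rewrite -(pmulr_rlt0 _ E0) /charfun.
(* Uses [E * dphi l pi = (w + v) / 2] and [E * phi l pi = (w - v) / (2 * k)]. The first summand is
   at least [k ^+ 4 / 4], the second smaller than that in absolute value. *)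
have -> : E * (l * (dphi l pi + H * phi l pi) - H1 * dphi l pi - H2 * phi l pi) =
    - (((k ^+ 2 + H1) * k * (w + v) + (k ^+ 2 * H + H2) * (w - v)) / (2 * k)).
  rewrite /w /v; move: (dphi l pi) (phi l pi) => b a; rewrite lk.
  by field; rewrite gt_eqF.
rewrite oppr_lt0 divr_gt0//; last by lra.
have C1 : 1 <= C by rewrite /C; have := normr_ge0 h; lra.
have kC : 4 * C <= k.
  move: Kk; rewrite /K.
  by move: (normr_ge0 H1) (normr_ge0 H) (normr_ge0 H2); lra.
have kH1 : 2 * `|H1| <= k.
  move: Kk; rewrite /K.
  by move: (normr_ge0 H1) (normr_ge0 H) (normr_ge0 H2); lra.
have kH : 8 * (`|H| + `|H2|) < k.
  move: Kk; rewrite /K.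
  by move: (normr_ge0 H1) (normr_ge0 H) (normr_ge0 H2); lra.
have k2k : k <= k ^+ 2 by nra.
have F1 : k ^+ 2 / 2 <= k ^+ 2 + H1.
  by move: (ler_norm (- H1)); rewrite normrN; lra.
have F2 : `|k ^+ 2 * H + H2| <= k ^+ 2 * (`|H| + `|H2|).
  rewrite mulrDr (le_trans (ler_normD _ _))// normrM (ger0_norm (sqr_ge0 k)) lerD2l.
  by rewrite ler_peMl//; lra.
have F3 : k / 2 <= w + v by lra.
have F4 : `|w - v| <= 2 * k by rewrite ler_norml; apply/andP; split; lra.
have G1 : k ^+ 2 / 2 * k * (k / 2) <= (k ^+ 2 + H1) * k * (w + v).
  by rewrite ler_pM ?ler_wpM2r ?mulr_ge0 ?divr_ge0 ?sqr_ge0//; lra.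
have G2 : `|(k ^+ 2 * H + H2) * (w - v)| <= k ^+ 2 * (`|H| + `|H2|) * (2 * k).
  by rewrite normrM ler_pM.
have G3 : k ^+ 2 * (`|H| + `|H2|) * (2 * k) < k ^+ 2 / 2 * k * (k / 2).
  have -> : k ^+ 2 / 2 * k * (k / 2) = k ^+ 2 * (k / 8) * (2 * k) by field.
  rewrite ltr_pM2r; last by lra.
  by rewrite ltr_pM2l ?exprn_gt0//; lra.
by move: G2; rewrite ler_norml => /andP[G2 _]; lra.
Qed.
End negative_spectral_parameter.

(** * Interlacing of the zeros of two continuous functions *)

Section interlacing.
Context {R : realType}.
Implicit Types (F G : R -> R) (a b d : R).

Lemma root_of_sign_change F a b : continuous F -> a < b -> F a * F b < 0 ->
  exists2 c, a < c < b & F c = 0.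
Proof.
move=> cF ab Fab.
have [||c] := @IVT R F a b 0 (ltW ab).
- exact: continuous_subspaceT.
- rewrite ge_min le_max; case: (lerP (F a) 0) => Fa; case: (lerP (F b) 0) => Fb //=; nra.
rewrite in_itv /= => /andP[ac cb] Fc; exists c => //.
rewrite !lt_neqAle ac cb !andbT; apply/andP; split.
  by apply: contraTneq Fab => ->; rewrite Fc mul0r ltxx.
by apply: contraTneq Fab => <-; rewrite Fc mulr0 ltxx.
Qed.

(** Near [a] the quotient [F x / (x - a)] is within [|d|] of [d], hence has its sign. *)
Lemma sign_near_simple_root F a d : is_derive a 1 F d -> F a = 0 -> d != 0 ->
  exists2 e, 0 < e & forall x, 0 < `|x - a| < e -> 0 < d * (x - a) * F x.
Proof.
move=> dF Fa d0.
have [dvF dE] := dF.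
have c : (fun t => t^-1 *: ((F \o shift a) (t *: (1:R)) - F a)) @ 0^' --> d.
  by rewrite -dE; exact: dvF.
have d0' : 0 < `|d| by rewrite normr_gt0.
move/cvgrPdist_lt : c => /(_ _ d0'); rewrite /dnbhs /= near_withinE.
move=> /nbhs_ballP[e /= e0 He]; exists e => // x /andP[xa0 xae].
have xa : x - a != 0 by rewrite -normr_gt0.
have := He (x - a); rewrite /ball /= sub0r normrN => /(_ xae xa).
rewrite /GRing.scale /= mulr1 subrK Fa subr0 => H.
have -> : d * (x - a) * F x = (x - a) ^+ 2 * (d * ((x - a)^-1 * F x)).
  by field.
rewrite mulr_gt0 ?exprn_even_gt0//.
move: H; set y := _^-1 * _; case: (ltrP 0 d) => [dp|dn].
  by rewrite (gtr0_norm dp) ltr_norml => /andP[? ?]; rewrite mulr_gt0//; lra.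
have {}dn : d < 0 by rewrite lt_neqAle d0.
by rewrite (ltr0_norm dn) ltr_norml => /andP[? ?]; rewrite nmulr_rgt0//; lra.
Qed.

(** [F] keeps one sign between consecutive simple zeros, so [da] and [db] have opposite signs; [G]
    shares these signs at [a] and [b], hence changes sign. *)
Lemma root_between F G a b da db : continuous F -> continuous G -> a < b ->
  F a = 0 -> F b = 0 -> (forall x, a < x < b -> F x != 0) ->
  is_derive a 1 F da -> is_derive b 1 F db -> 0 < da * G a -> 0 < db * G b ->
  exists2 c, a < c < b & G c = 0.
Proof.
move=> cF cG ab Fa Fb nF dFa dFb Ga Gb.
have da0 : da != 0 by apply: contraTneq Ga => ->; rewrite mul0r ltxx.
have db0 : db != 0 by apply: contraTneq Gb => ->; rewrite mul0r ltxx.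
have [e e0 He] := sign_near_simple_root dFa Fa da0.
have [e' e'0 He'] := sign_near_simple_root dFb Fb db0.
(* With a third of [r] the sample points [a + r / 3] and [b - r / 3] lie in the two neighbourhoods
   and stay in order inside the interval. *)
pose r := Num.min (Num.min e e') (b - a).
have r0 : 0 < r by rewrite !lt_min e0 e'0 subr_gt0.
have : r <= r by [].
rewrite {2}/r !le_min => /andP[/andP[re re'] rab].
have := He (a + r / 3); have := He' (b - r / 3).
rewrite (_ : a + r / 3 - a = r / 3); last by ring.
rewrite (_ : b - r / 3 - b = - (r / 3)); last by ring.
rewrite normrN ger0_norm; last by lra.
move=> /(_ ltac:(apply/andP; split; lra)) Fy /(_ ltac:(apply/andP; split; lra)) Fx.
have x1 : F (a + r / 3) != 0 by apply: nF; apply/andP; split; lra.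
have y1 : F (b - r / 3) != 0 by apply: nF; apply/andP; split; lra.
have Fxy : 0 < F (a + r / 3) * F (b - r / 3).
  rewrite lt_neqAle eq_sym mulf_neq0//= leNgt; apply/negP => neg.
  have [|c c12 Fc] := root_of_sign_change cF _ neg; first by lra.
  have /nF : a < c < b by case/andP: c12 => *; apply/andP; split; lra.
  by rewrite Fc eqxx.
apply: root_of_sign_change => //.
have Fx' : 0 < da * F (a + r / 3).
  by rewrite -(pmulr_rgt0 _ (_ : 0 < r / 3)); lra.
have Fy' : 0 < - db * F (b - r / 3).
  by rewrite -(pmulr_rgt0 _ (_ : 0 < r / 3)); lra.
have D : da * db < 0.
  have := mulr_gt0 Fx' Fy'.
  rewrite [X in 0 < X -> _](_ : _ = - (da * db) * (F (a + r / 3) * F (b - r / 3))); last by ring.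
  by rewrite pmulr_lgt0// oppr_gt0.
have := mulr_gt0 Ga Gb.
rewrite [X in 0 < X -> _](_ : _ = (da * db) * (G a * G b)); last by ring.
by rewrite nmulr_rgt0.
Qed.

Lemma enumeration_mono (E : R -> Prop) (e : nat -> R) :
  increasing_enumeration E e -> {mono e : m n / (m <= n)%N >-> m <= n}.
Proof.
move=> [inc _]; apply: le_mono => m n; exact: (@homo_ltn _ e (fun x y => x < y)) lt_trans inc m n.
Qed.

Lemma enumeration_consecutive (E : R -> Prop) (e : nat -> R) n x :
  increasing_enumeration E e -> e n < x < e n.+1 -> ~ E x.
Proof.
move=> ie; have mo : {mono e : m n / (m < n)%N >-> m < n}.
  exact: leW_mono (enumeration_mono ie).
move=> /andP[nx xn] /(ie.2)[m xm]; move: nx xn; rewrite xm !mo ltnS.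
by move=> nm mn; move: (leq_trans nm mn); rewrite ltnn.
Qed.

Lemma interlacing F G (lam mu : nat -> R) L :
  continuous F -> continuous G ->
  increasing_enumeration (fun l => F l = 0) lam ->
  increasing_enumeration (fun l => G l = 0) mu ->
  (forall l, F l = 0 -> exists2 d, is_derive l 1 F d & d * G l < 0) ->
  (forall l, G l = 0 -> exists2 d, is_derive l 1 G d & 0 < d * F l) ->
  (forall l, l < L -> F l < 0 /\ G l < 0) ->
  forall n, lam n < mu n /\ mu n < lam n.+1.
Proof.
move=> cF cG ilam imu dF dG neg.
have lamr n : F (lam n) = 0 by apply/(ilam.2); exists n.
have mur n : G (mu n) = 0 by apply/(imu.2); exists n.
have lamm := enumeration_mono ilam; have mum := enumeration_mono imu.
have laml : {mono lam : m n / (m < n)%N >-> m < n} by exact: leW_mono.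
have mul : {mono mu : m n / (m < n)%N >-> m < n} by exact: leW_mono.
have A n : exists m, lam n < mu m < lam n.+1.
  have [d1 D1 G1] := dF _ (lamr n); have [d2 D2 G2] := dF _ (lamr n.+1).
  (* The hypothesis at the zeros of [F] has the opposite sign, whence [- G]. *)
  have [||||c cb /eqP] := @root_between F (fun x => - G x) _ _ _ _ cF _ (ilam.1 n)
    (lamr _) (lamr _) _ D1 D2.
  - by move=> x; apply: cvgN; exact: cG.
  - by move=> x /(enumeration_consecutive ilam)/eqP.
  - by rewrite mulrN oppr_gt0.
  - by rewrite mulrN oppr_gt0.
  by rewrite oppr_eq0 => /eqP /(imu.2)[m cm]; exists m; rewrite -cm.
have B n : exists m, mu n < lam m < mu n.+1.
  have [d1 D1 G1] := dG _ (mur n); have [d2 D2 G2] := dG _ (mur n.+1).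
  have [|c cb] := @root_between G F _ _ _ _ cG cF (imu.1 n)
    (mur _) (mur _) _ D1 D2 G1 G2.
  - by move=> x /(enumeration_consecutive imu)/eqP.
  by move=> /(ilam.2)[m cm]; exists m; rewrite -cm.
(* Otherwise [F] has no zero up to [mu 0] and stays negative there, so [G] has negative derivative
   at [mu 0] and is positive just to its left. As [G] is negative far to the left, it would have a
   zero below [mu 0]. *)
have C : lam 0%N < mu 0%N.
  rewrite ltNge; apply/negP => ml0.
  have ml : mu 0%N < lam 0%N.
    rewrite lt_neqAle ml0 andbT; apply/eqP => E.
    have [d _] := dF _ (lamr 0%N).
    by rewrite -E mur mulr0 ltxx.
  have [d D dFm] := dG _ (mur 0%N).
  have d0 : d != 0 by apply: contraTneq dFm => ->; rewrite mul0r ltxx.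
  have Fm : F (mu 0%N) != 0 by apply: contraTneq dFm => ->; rewrite mulr0 ltxx.
  have [e e0 He] := sign_near_simple_root D (mur 0%N) d0.
  pose x := mu 0%N - e / 2.
  pose p := Num.min x L - 1.
  have [px pL] : p < x /\ p < L.
    have : Num.min x L <= Num.min x L by [].
    by rewrite le_min /p => /andP[? ?]; split; lra.
  have [Fp Gp] := neg _ pL.
  have pm : p < mu 0%N by rewrite /x in px; lra.
  have Fm0 : F (mu 0%N) < 0.
    rewrite lt_neqAle Fm leNgt /=; apply/negP => Fpos.
    have [|c /andP[_ cm] /(ilam.2)[n cn]] := root_of_sign_change cF pm.
      by rewrite nmulr_rlt0.
    have : lam n < lam 0%N by rewrite -cn (lt_trans cm).
    by rewrite laml.
  have dn : d < 0 by move: dFm; rewrite nmulr_lgt0.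
  have Gx : 0 < G x.
    have := He x; rewrite /x addrAC subrr add0r normrN gtr0_norm; last by lra.
    move=> /(_ ltac:(apply/andP; split; lra)); rewrite pmulr_rgt0//.
    by rewrite nmulr_rgt0//; lra.
  have [|c /andP[_ cm] /(imu.2)[n cn]] := root_of_sign_change cG px.
    by rewrite nmulr_rlt0.
  have : mu n < mu 0%N by rewrite -cn (lt_trans cm)// /x; lra.
  by rewrite mul.
(* A zero found by [A] or [B] beyond the current one has a larger index, so the next zero of that
   function does not exceed it. *)
elim=> [|n [IH1 IH2]]; split => //.
- have [m /andP[lm ml]] := A 0%N; apply: le_lt_trans ml.
  by rewrite mum.
- have [k /andP[lm ml]] := B n; apply: le_lt_trans ml.
  by rewrite lamm -laml (lt_trans IH1).
- have [m /andP[lm ml]] := A n.+1; apply: le_lt_trans ml.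
  by rewrite mum -mul (lt_trans IH2).
Qed.

End interlacing.

Theorem mainTheorem6 (R : realType) (q : R -> R) (h ht H H1 H2 : R)
    (phi dphi psi dpsi : R -> R -> R) (lam mu : nat -> R)
    (hq : inL2 q) (hht : h < ht) (hrho : 0 < H * H1 - H2)
    (hphi : normalized_solutions q h phi dphi)
    (hpsi : normalized_solutions q ht psi dpsi)
    (hlam : increasing_enumeration (sl_eigenvalue q h H H1 H2) lam)
    (hmu : increasing_enumeration (sl_eigenvalue q ht H H1 H2) mu) :
  let Phi := charfun H H1 H2 phi dphi in
  let Psi := charfun H H1 H2 psi dpsi in
  (forall n, lam n < mu n /\ mu n < lam n.+1) /\
  (forall n,
     [/\ derivable Phi (lam n) 1,
         Psi (lam n) != 0 &
         norming_constant H H1 H2 phi dphi (lam n)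
         = (h - ht) * (derive1 Phi (lam n) / Psi (lam n))]).
Proof.
move=> Phi Psi.
have iq := inL2_L1 hq.
have hne : h != ht by rewrite lt_eqF.
have htne : ht != h by rewrite eq_sym.
have rho0 : H * H1 - H2 != 0 by rewrite gt_eqF.
have eigF l : sl_eigenvalue q h H H1 H2 l <-> Phi l = 0.
  exact: (sl_eigenvalueP iq hne hphi hpsi).
(* The results on two solutions require only distinct slopes at 0, so they apply with [phi] and
   [psi] exchanged. *)
have eigG l : sl_eigenvalue q ht H H1 H2 l <-> Psi l = 0.
  exact: (sl_eigenvalueP iq htne hpsi hphi).
have ilam : increasing_enumeration (fun l => Phi l = 0) lam.
  by split; [exact: hlam.1|move=> l; rewrite -eigF; exact: hlam.2].
have imu : increasing_enumeration (fun l => Psi l = 0) mu.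
  by split; [exact: hmu.1|move=> l; rewrite -eigG; exact: hmu.2].
split.
  have [L1 negF] := charfun_lt0 iq H H1 H2 hphi.
  have [L2 negG] := charfun_lt0 iq H H1 H2 hpsi.
  apply: (@interlacing _ Phi Psi _ _ (Num.min L1 L2)) => //.
  - exact: (charfun_continuous iq hne hphi hpsi).
  - exact: (charfun_continuous iq htne hpsi hphi).
  - move=> l Pl; have [k0 kPsi D] := charfun_at_root iq hne hphi hpsi hrho Pl.
    have g0 := norming_constant_gt0 iq hne hphi hpsi hrho Pl.
    eexists; first exact: D.
    set k := _ + _ in k0 kPsi *.
    have -> : Psi l = (H * H1 - H2) * (h - ht) / k.
      by rewrite -kPsi mulrC mulKf.
    (* The unknown sign of [k] enters squared, so [h - ht] decides the sign. *)
    rewrite [X in X < 0](_ : _ = ((H * H1 - H2) / k) ^+ 2 *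
      norming_constant H H1 H2 phi dphi l * (h - ht)); last by field.
    rewrite pmulr_rlt0 ?subr_lt0// mulr_gt0// exprn_even_gt0//= mulf_neq0//.
    by rewrite invr_neq0.
  - move=> l Pl; have [k0 kPsi D] := charfun_at_root iq htne hpsi hphi hrho Pl.
    have g0 := norming_constant_gt0 iq htne hpsi hphi hrho Pl.
    eexists; first exact: D.
    set k := _ + _ in k0 kPsi *.
    have -> : Phi l = (H * H1 - H2) * (ht - h) / k.
      by rewrite -kPsi mulrC mulKf.
    rewrite [X in 0 < X](_ : _ = ((H * H1 - H2) / k) ^+ 2 *
      norming_constant H H1 H2 psi dpsi l * (ht - h)); last by field.
    rewrite pmulr_rgt0 ?subr_gt0// mulr_gt0// exprn_even_gt0//= mulf_neq0//.
    by rewrite invr_neq0.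
  - move=> l; rewrite lt_min => /andP[l1 l2]; split; [exact: negF|exact: negG].
move=> n; have Pl : Phi (lam n) = 0 by apply/(ilam.2); exists n.
have [k0 kPsi D] := charfun_at_root iq hne hphi hpsi hrho Pl.
set k := _ + _ in k0 kPsi D.
have PsiE : Psi (lam n) = (H * H1 - H2) * (h - ht) / k.
  by rewrite -kPsi mulrC mulKf.
have D0 : h - ht != 0 by rewrite subr_eq0.
split.
- by have [] := D.
- by rewrite PsiE !mulf_neq0// invr_neq0.
- rewrite derive1E derive_val PsiE; field; rewrite k0 D0 rho0 //.
Qed.
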